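(* Let $m \geq 3$ and $T$ a complete $m$-ary tree with height $h$, then $\mathrm{thin}(T) = \lceil\frac{h+1}{2}\rceil$.
   Context: A graph $G$ is $k$-thin if there exist a strict total order $\prec$ on $V(G)$ and a partition of $V(G)$ into $k$ classes such that for all $u \prec v \prec w$ with $u,v$ in the same class and $(u,w)\in E(G)$, also $(v,w)\in E(G)$; the thinness $\mathrm{thin}(G)$ is the minimum such $k$. An $m$-ary tree is a rooted tree in which every non-leaf vertex has $m$ children; it is complete if all leaves are at the same distance from the root. The height is the maximum number of edges on a path from the root to a leaf. *)

(* Defs.v *)
From mathcomp Require Import all_boot.
From mathcomp Require Import boolp.

Set Implicit Arguments.
Unset Strict Implicit.
Unset Printing Implicit Defensive.

Record sgraph := SGraph {
  vertex :> finType;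
  adj : rel vertex;
  adj_sym : symmetric adj;
  adj_irr : irreflexive adj
}.
Arguments adj {G} : rename.

Section Thinness.
Variable G : sgraph.

Definition strict_total_order (prec : rel G) : Prop :=
  [/\ irreflexive prec, transitive prec
    & forall u v : G, u != v -> prec u v || prec v u].

Definition consistent (prec : rel G) (P : {set {set G}}) : Prop :=
  forall u v w : G, prec u v -> prec v w ->
    pblock P u = pblock P v -> adj u w -> adj v w.

(* The classes of a [partition] are nonempty. Allowing empty classes would
   make [k_thin] monotone in [k] without changing the least [k]. *)
Definition k_thin (k : nat) : Prop :=
  exists (prec : rel G) (P : {set {set G}}),
    [/\ strict_total_order prec, partition P [set: G], #|P| = k
      & consistent prec P].

Lemma ex_k_thin : exists k, `[< k_thin k >].
Proof.
pose P := preim_partition (@id G) [set: G].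
exists #|P|; apply/asboolP.
exists (fun u v => enum_rank u < enum_rank v), P.
have partP : partition P [set: G] := preim_partitionP id [set: G].
split=> //.
- split=> [u | v u w | u v neq_uv]; first exact: ltnn.
  + exact: ltn_trans.
  + by rewrite -neq_ltn; apply: contraNneq neq_uv => /val_inj/enum_rank_inj->.
- move=> u v w lt_uv _ eq_uv.
  suff eqv : u = v by rewrite eqv ltnn in lt_uv.
  have : v \in pblock P u.
    by rewrite eq_uv mem_pblock (cover_partition partP) inE.
  have eqR : {in [set: G] & &, equivalence_rel [rel x y : G | x == y]}.
    by move=> x y z _ _ _ /=; split=> // /eqP->.
  by rewrite (pblock_equivalence_partition eqR) ?inE // => /eqP.
Qed.

Definition thin : nat := ex_minn ex_k_thin.

End Thinness.

Section RootedTrees.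
Variable G : sgraph.

Definition is_tree : Prop :=
  [/\ 0 < #|G|, forall x y : G, connect adj x y
    & forall c : seq G, ucycle adj c -> size c <= 2].

(* Least number of edges of a walk from x to y; the value is #|G| when there
   is none. *)
Definition dist (x y : G) : nat :=
  find (fun n => [exists p : n.-tuple G, path adj x p && (last x p == y)])
       (iota 0 #|G|).

Variable r : G.

Definition children (x : G) : {set G} :=
  [set y | adj x y & dist r y == (dist r x).+1].

(* In particular the root of the one-vertex tree is a leaf. *)
Definition leaf (x : G) : bool := children x == set0.

Definition mary_tree (m : nat) : Prop :=
  is_tree /\ forall x : G, ~~ leaf x -> #|children x| = m.

Definition complete_mary_tree (m : nat) : Prop :=
  mary_tree m /\
  forall x y : G, leaf x -> leaf y -> dist r x = dist r y.

(* A simple path has fewer than #|G| edges, so the bound on n loses nothing. *)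
Definition height : nat :=
  \max_(n < #|G| | [exists p : n.-tuple G,
           [&& path adj r p, uniq (r :: p) & leaf (last r p)]]) n.

End RootedTrees.

(* Main.v *)
Require Import Defs.
From mathcomp Require Import all_boot.
From mathcomp Require Import boolp.
From mathcomp Require Import all_order.
From mathcomp Require Import zify.

(** Lower bound: for a fixed order, call [u < v] conflicting if some [w > v] is
adjacent to [u] but not to [v]; conflicting vertices lie in different classes.
By induction on [n], below a vertex of height at least [2n] there are [n + 1]
pairwise conflicting vertices.  For the step, pick a grandchild in each of three
child subtrees, apply induction below each, and let [c] be the maximum of a
conflicting set [S] whose maximum is the middle one of the three.  The other
two maxima are joined by a path avoiding the child subtree containing [S], so
some edge [a b] of this path satisfies [a < c < b], and [a] conflicts with all
of [S].

Upper bound: put the vertices of heights [2i] and [2i + 1] in one class, and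
order the tree recursively so that a vertex of even height precedes its proper
descendants and a vertex of odd height follows them. *)

Set Implicit Arguments.
Unset Strict Implicit.
Unset Printing Implicit Defensive.

Import Order.Theory.

(** * Shortest walks and distance *)

Section Distance.
Variable G : sgraph.
Implicit Types x y z : G.

Lemma uniq_size_lt_card x (p : seq G) : uniq (x :: p) -> size p < #|G|.
Proof.
move=> p_uniq; rewrite cardE.
exact: uniq_leq_size p_uniq (fun z _ => mem_enum G z).
Qed.

(** A walk shortened to a simple path has fewer than [#|G|] edges, so its length lies in the range
    that [dist] searches. *)
Lemma dist_path_le x p : path adj x p -> dist x (last x p) <= size p.
Proof.
case/shortenP=> q q_path q_uniq q_sub.
have le_qp : size q <= size p.
  by apply: uniq_leq_size => //; case/andP: q_uniq.
apply: leq_trans le_qp; rewrite leqNgt; apply/negP => lt_q.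
have ltG := uniq_size_lt_card q_uniq.
have := before_find 0 lt_q; rewrite nth_iota //= add0n => /negbT/negP[].
by apply/existsP; exists (in_tuple q); rewrite q_path eqxx.
Qed.

Lemma dist_pathP x y :
  connect adj x y ->
  exists p, [/\ path adj x p, last x p = y & size p = dist x y].
Proof.
case/connectP=> p /shortenP[q q_path q_uniq _] ->.
set a := fun n => [exists p : n.-tuple G, path adj x p && (last x p == last x q)].
have has_a : has a (iota 0 #|G|).
  apply/hasP; exists (size q).
    by rewrite mem_iota add0n (uniq_size_lt_card q_uniq).
  by apply/existsP; exists (in_tuple q); rewrite q_path eqxx.
have := nth_find 0 has_a; rewrite nth_iota; last first.
  by rewrite -[X in _ < X](size_iota 0) -has_find.
rewrite add0n => /existsP[s /andP[s_path /eqP s_last]].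
by exists s; rewrite size_tuple.
Qed.

End Distance.

(** * Depth and parents in a rooted tree *)

Section Tree.
Variables (T : sgraph) (r : T).
Hypothesis treeT : is_tree T.
Implicit Types x y z u v w : T.

Local Notation depth := (dist r).

Lemma depth_connected x : connect adj r x.
Proof. by case: treeT => _ + _; apply. Qed.

Lemma depth_root : depth r = 0.
Proof. by have := @dist_path_le _ r [::] isT; rewrite leqn0 => /eqP. Qed.

Lemma depth_eq0 x : (depth x == 0) = (x == r).
Proof.
apply/eqP/eqP=> [|->]; last exact: depth_root.
have [p [_ <- <-]] := dist_pathP (depth_connected x).
by move/size0nil->.
Qed.

Lemma depth_adj x y : adj x y -> depth y <= (depth x).+1.
Proof.
move=> xy; have [p [p_path p_last <-]] := dist_pathP (depth_connected x).
have := @dist_path_le _ r (rcons p y).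
by rewrite rcons_path last_rcons size_rcons p_path p_last; apply.
Qed.

Lemma exists_parent x : x != r -> exists2 y, adj x y & depth x = (depth y).+1.
Proof.
have [p [p_path p_last p_size]] := dist_pathP (depth_connected x).
case/lastP: p p_path p_last p_size => [_ <- |p z]; first by rewrite eqxx.
rewrite rcons_path last_rcons size_rcons => /andP[p_path lz] zx size_p _.
rewrite {}zx in lz; exists (last r p); first by rewrite adj_sym.
apply/eqP; rewrite eqn_leq depth_adj // -size_p ltnS.
exact: dist_path_le.
Qed.

(** The strict bound lets a walk that starts at a neighbour of [z], no deeper than [z], avoid
    [z]. *)
Lemma walk_to_root x : exists p,
  [/\ path adj x p, last x p = r & forall y, y \in p -> depth y < depth x].
Proof.
have [n le_n] := ubnP (depth x); elim: n x le_n => // n IHn x le_n.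
have [-> | /exists_parent[y xy dxy]] := eqVneq x r; first by exists [::].
have [|p [p_path p_last lt_p]] := IHn y; first by rewrite -ltnS -dxy.
exists (y :: p); split=> //=; first by rewrite xy.
move=> z; rewrite inE => /orP[/eqP-> | /lt_p]; rewrite dxy //; exact: leqW.
Qed.

(** If [y1] and [y2] differed, a simple path between them avoiding [z] would close up through [z] to
    a cycle of length at least three. *)
Lemma no_bypass z y1 y2 :
  adj z y1 -> adj z y2 ->
  connect [rel u v | adj u v && (v != z)] y1 y2 -> y1 = y2.
Proof.
move=> zy1 zy2 /connectP[p /shortenP[q q_path q_uniq _] y2E].
have [//|neq_y] := eqVneq y1 y2.
have zNq : z \notin q.
  elim: q (y1) q_path {q_uniq y2E} => //= u q IHq y /andP[/andP[_ uz] q_path].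
  by rewrite inE negb_or eq_sym uz (IHq u).
have q_adj : path adj y1 q by apply: sub_path q_path => u v /andP[].
have q_size : 0 < size q by case: (q) y2E neq_y => //= ->; rewrite eqxx.
have [_ _ acyclic] := treeT.
suff /acyclic : ucycle adj (z :: y1 :: q) by rewrite /= !ltnS leqNgt q_size.
rewrite /ucycle /= rcons_path zy1 q_adj -y2E adj_sym zy2 inE negb_or zNq /=.
move: q_uniq => /= ->; rewrite !andbT.
by apply: contraTneq zy1 => <-; rewrite adj_irr.
Qed.

(** Both neighbours reach the root without meeting [z], so joining the two walks at the root
    bypasses [z]. Allowing equal depth also rules out edges within a level. *)
Lemma lower_neighbour_unique z y1 y2 :
  adj z y1 -> adj z y2 -> depth y1 <= depth z -> depth y2 <= depth z -> y1 = y2.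
Proof.
move=> zy1 zy2 le1 le2; apply: (no_bypass zy1 zy2).
have to_root y : adj z y -> depth y <= depth z ->
    connect [rel u v | adj u v && (v != z)] y r /\
    connect [rel u v | adj u v && (v != z)] r y.
  move=> zy le_y; have [p [p_path p_last lt_p]] := walk_to_root y.
  have yz : y != z by apply: contraTneq zy => ->; rewrite adj_irr.
  have pz u : u \in y :: p -> u != z.
    rewrite inE => /orP[/eqP-> // | /lt_p lt_u].
    by apply: contraTneq lt_u => ->; rewrite -leqNgt.
  (* Excluding [z] at both ends of each edge makes the path reversible. *)
  have h_path : path [rel u v | [&& adj u v, u != z & v != z]] y p.
    elim: (p) (y) p_path pz => //= u q IHq x /andP[xu q_path] xz.
    rewrite xu !xz ?inE ?eqxx ?orbT //= IHq // => w w_in.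
    by rewrite xz // inE w_in orbT.
  split; apply/connectP.
    by exists p => //; apply: sub_path h_path => u v /= /and3P[-> _ ->].
  exists (rev (belast y p)); last first.
    by rewrite -p_last; case: (p) => //= u q; rewrite rev_cons last_rcons.
  rewrite -p_last rev_path; apply: sub_path h_path => u v /= /and3P[uv -> _].
  by rewrite adj_sym uv.
have [c1 _] := to_root y1 zy1 le1; have [_ c2] := to_root y2 zy2 le2.
exact: connect_trans c1 c2.
Qed.

(** The default makes the root a fixed point, so iterates of [parent] stop there. *)
Definition parent x : T :=
  if [pick y | adj x y && (depth y < depth x)] is Some y then y else x.

Lemma parent_root : parent r = r.
Proof. by rewrite /parent; case: pickP => // y; rewrite depth_root andbF. Qed.

Lemma parentP x : x != r -> adj x (parent x) /\ depth x = (depth (parent x)).+1.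
Proof.
move=> /exists_parent[y xy dxy]; rewrite /parent.
case: pickP => [z /andP[xz lt_z] | /(_ y)]; last by rewrite xy dxy ltnSn.
by rewrite (@lower_neighbour_unique x z y) // ?dxy // -?dxy // ltnW.
Qed.

Lemma adj_parent x y : adj x y -> x != r /\ parent x = y \/ y != r /\ parent y = x.
Proof.
move=> xy.
have aux u v : adj u v -> depth v <= depth u -> u != r /\ parent u = v.
  move=> uv le_vu; have ur : u != r.
    apply: contraTneq uv => ur; rewrite ur depth_root leqn0 depth_eq0 in le_vu.
    by rewrite (eqP le_vu) ur adj_irr.
  split=> //; have [up du] := parentP ur.
  by apply: (@lower_neighbour_unique u) => //; rewrite du.
case: (leqP (depth y) (depth x)) => [|/ltnW] le; first by left; apply: aux.
by right; apply: aux; rewrite // adj_sym.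
Qed.

Lemma depth_iter_parent k x : depth (iter k parent x) = depth x - k.
Proof.
elim: k => [|k IHk] /=; first by rewrite subn0.
have [kr | /parentP[_]] := eqVneq (iter k parent x) r; last by lia.
by rewrite kr parent_root; move: IHk; rewrite kr depth_root; lia.
Qed.

Lemma mem_children x y : (y \in children r x) = (y != r) && (parent y == x).
Proof.
rewrite inE; apply/andP/andP=> [[xy /eqP dy] | [/parentP[yp dy] /eqP<-]].
  case: (adj_parent xy) => [[xr px] | [-> ->]]; last by rewrite eqxx.
  by have [_] := parentP xr; rewrite px dy; lia.
by rewrite adj_sym yp dy.
Qed.

(** After a step away from the root, the only neighbour that is not deeper is the vertex just left,
    which simplicity forbids. The condition on neighbours covers the first step. *)
Lemma depth_simple_path x p :
  path adj x p -> uniq (x :: p) ->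
  (forall y, adj x y -> depth y <= depth x -> y \notin p) ->
  depth (last x p) = depth x + size p.
Proof.
elim: p x => [|y p IHp] x /=; first by rewrite addn0.
case/andP=> xy p_path /and3P[]; rewrite inE negb_or => /andP[neq_xy xNp] yNp Up up.
have lt_xy : depth x < depth y.
  by rewrite ltnNge; apply/negP => /(up y xy); rewrite inE eqxx.
have dy : depth y = (depth x).+1 by apply/eqP; rewrite eqn_leq depth_adj.
rewrite IHp /= ?yNp //; first by rewrite dy addSnnS.
move=> z yz le_z.
have yx : adj y x by rewrite adj_sym.
by rewrite (lower_neighbour_unique yz yx le_z (ltnW lt_xy)).
Qed.


(** * Ancestors and subtrees *)

Definition descendant x y := fconnect parent y x.

Lemma descendant_refl x : descendant x x.
Proof. exact: connect0. Qed.

Lemma descendant_trans x y z : descendant x y -> descendant y z -> descendant x z.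
Proof. by move=> xy yz; apply: connect_trans yz xy. Qed.

Lemma descendant_iter x y : descendant x y -> exists k, iter k parent y = x.
Proof. by move=> xy; exists (findex parent y x); apply: iter_findex. Qed.

Lemma parent_descendant x y : y != x -> descendant x y -> descendant x (parent y).
Proof.
move=> neq_yx /descendant_iter[[|k] xE]; first by rewrite -xE eqxx in neq_yx.
by rewrite -xE iterSr; apply: fconnect_iter.
Qed.

Lemma depth_descendant x y : descendant x y -> depth x <= depth y.
Proof. by case/descendant_iter=> k <-; rewrite depth_iter_parent leq_subr. Qed.

(** Both are iterates of [parent] at [z]; the depth fixes the number of iterations until the root,
    where all later iterates coincide. *)
Lemma descendant_depth_inj x y z :
  descendant x z -> descendant y z -> depth x = depth y -> x = y.
Proof.
case/descendant_iter=> k <- /descendant_iter[l <-].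
rewrite !depth_iter_parent => eq_kl.
have [lt_k | le_k] := ltnP k (depth z); first by have -> : k = l by lia.
have root i : depth z <= i -> iter i parent z = r.
  by move=> le_i; apply/eqP; rewrite -depth_eq0 depth_iter_parent subn_eq0.
by rewrite !root //; lia.
Qed.

(** The only edge leaving the subtree of [u] goes from [u] to its parent, so one more level absorbs
    all neighbours of the subtree. *)
Lemma adj_descendant u y z :
  adj y z -> descendant u y -> descendant (parent u) z.
Proof.
move=> yz uy; have pu : descendant (parent u) u by apply: fconnect1.
case: (adj_parent yz) => -[_ eq_p].
  rewrite -eq_p.
  have [-> | neq_yu] := eqVneq y u; first exact: descendant_refl.
  exact: descendant_trans pu (parent_descendant neq_yu uy).
apply: descendant_trans pu (descendant_trans uy _).
by rewrite -eq_p; apply: fconnect1.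
Qed.

(** * Lower bound: pairwise conflicting vertices *)

Section LowerBound.
Variable prec : rel T.
Hypothesis prec_order : strict_total_order prec.

Let prec_irr x : prec x x = false.
Proof. by case: prec_order => irr _ _; apply: irr. Qed.

Let prec_trans : transitive prec.
Proof. by case: prec_order. Qed.

Let prec_total x y : x != y -> prec x y || prec y x.
Proof. by case: prec_order => _ _; apply. Qed.

Lemma prec_max (S : {set T}) x :
  x \in S -> exists2 c, c \in S & {in S, forall s, s != c -> prec s c}.
Proof.
move=> xS; pose below y := [set z | prec z y].
case: (arg_maxnP (fun y => #|below y|) xS) => c cS c_max.
exists c => // s sS neq_sc; have /orP[//|cs] := prec_total neq_sc.
have /= := c_max s sS; rewrite leqNgt => /negP[]; apply: proper_card.
apply/properP; split; last by exists c; rewrite !inE ?prec_irr.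
by apply/subsetP => z; rewrite !inE => /prec_trans; apply.
Qed.

(** Keeping the witness [w] below [x] ensures that vertices added later from outside are not
    adjacent to it. *)
Definition conflicting (S : {set T}) x : Prop :=
  {in S &, forall u v, prec u v ->
    exists w, [/\ descendant x w, prec v w, adj u w & ~~ adj v w]}.

(** The subtree of [x] without that of [v] is connected through parent paths to [x], so without a
    crossing edge [Q] would be constant on it. *)
Lemma edge_across (Q : pred T) x v y1 y2 :
  descendant x y1 -> ~~ descendant v y1 -> descendant x y2 -> ~~ descendant v y2 ->
  Q y1 -> ~~ Q y2 ->
  exists a b, [/\ adj a b, descendant x a && ~~ descendant v a,
                  descendant x b && ~~ descendant v b, Q a & ~~ Q b].
Proof.
move=> xy1 vy1 xy2 vy2 Q1 Q2; apply: contrapT => no_edge.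
suff const y : descendant x y -> ~~ descendant v y -> Q y = Q x.
  by rewrite const // -(const y1) // Q1 in Q2.
case/descendant_iter=> k; elim: k y => [|k IHk] y /=; first by move->.
rewrite -iterS iterSr => xE vy.
have vp : ~~ descendant v (parent y).
  by apply: contra vy => /descendant_trans; apply; apply: fconnect1.
rewrite -(IHk (parent y)) //.
have [-> | /parentP[yp _]] := eqVneq y r; first by rewrite parent_root.
have xp : descendant x (parent y) by rewrite -xE; apply: fconnect_iter.
have xy : descendant x y by apply: descendant_trans xp (fconnect1 _ _).
apply/idP/idP => [Qy | Qp]; apply: contrapT => /negP nQ; apply: no_edge.
  by exists y, (parent y); rewrite xy vy xp vp.
by exists (parent y), y; rewrite adj_sym xy vy xp vp.
Qed.

(** [S] and its witnesses lie below [u] rather than anywhere below [v]: by [adj_descendant] this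
    spare level separates them from all vertices outside the subtree of [v]. *)
Definition crown n v c : Prop :=
  exists (S : {set T}) u, [/\ #|S| = n.+1, parent u = v & c \in S] /\
    [/\ {in S, forall s, descendant u s}, conflicting S u
      & {in S, forall s, s != c -> prec s c}].

Lemma crown_descendant n v c : crown n v c -> descendant v c.
Proof.
case=> S [u [[_ <- cS] [Su _ _]]].
by apply: descendant_trans (Su c cS); apply: fconnect1.
Qed.

Lemma conflicting_extend n x v1 v2 v3 c1 c2 c3 :
  v1 \in children r x -> v2 \in children r x -> v3 \in children r x ->
  v1 != v2 -> v3 != v2 ->
  crown n v1 c1 -> crown n v2 c2 -> crown n v3 c3 -> prec c1 c2 -> prec c2 c3 ->
  exists S : {set T},
    [/\ #|S| = n.+2, {in S, forall s, descendant x s} & conflicting S x].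
Proof.
move=> v1x v2x v3x neq12 neq32 cr1 cr2 cr3 c12 c23.
have dv v : v \in children r x -> depth v = (depth x).+1.
  by rewrite inE => /andP[_ /eqP].
have xv v : v \in children r x -> descendant x v.
  by rewrite mem_children => /andP[_ /eqP<-]; apply: fconnect1.
have out v c : v \in children r x -> v != v2 -> crown n v c ->
    descendant x c /\ ~~ descendant v2 c.
  move=> vx neq_v /crown_descendant vc; split.
    exact: descendant_trans (xv v vx) vc.
  apply: contra neq_v => v2c; apply/eqP/(descendant_depth_inj vc v2c).
  by rewrite (dv v) // (dv v2).
have [xc1 v2c1] := out _ _ v1x neq12 cr1; have [xc3 v2c3] := out _ _ v3x neq32 cr3.
have nc3 : ~~ prec c3 c2.
  by apply/negP => /(prec_trans c23); rewrite prec_irr.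
have [a [b [ab /andP[xa v2a] /andP[xb v2b] ac2 nbc2]]] :=
  edge_across (Q := fun y => prec y c2) xc1 v2c1 xc3 v2c3 c12 nc3.
case: cr2 => S [u [[cardS pu c2S] [Su Sconf Smax]]].
have v2u : descendant v2 u by rewrite -pu; apply: fconnect1.
have c2b : prec c2 b.
  have neq_b : b != c2.
    by apply: contraNneq v2b => ->; apply: descendant_trans v2u (Su _ c2S).
  by have := prec_total neq_b; rewrite (negbTE nbc2).
have far y z : descendant u y -> ~~ descendant v2 z -> ~~ adj y z.
  by move=> uy; apply: contra => yz; rewrite -pu; apply: adj_descendant uy.
have v2S s : s \in S -> descendant v2 s by move/Su; apply: descendant_trans.
exists (a |: S); split.
- rewrite cardsU1 cardS (_ : a \notin S) //.
  by apply: contra v2a => /v2S.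
- move=> s /setU1P[-> // | /v2S]; exact: descendant_trans (xv _ v2x).
move=> s t /setU1P[-> | sS] /setU1P[-> | tS]; first by rewrite prec_irr.
(* [b] comes after [c2], the maximum of [S], hence after [t], and lies outside the subtree of
   [v2]. *)
- move=> a_t; exists b; split=> //; last exact: far (Su _ tS) v2b.
  by have [-> // | /(Smax t tS)/prec_trans->] := eqVneq t c2.
(* The witness separating [s] from [c2] also serves for [a]: it comes after [c2], hence after
   [a]. *)
- move=> s_a; have s_c2 : prec s c2 := prec_trans s_a ac2.
  have [w [uw c2w sw _]] := Sconf s c2 sS c2S s_c2.
  exists w; split=> //; last by rewrite adj_sym far.
    by apply: descendant_trans (xv _ v2x) (descendant_trans v2u uw).
  exact: prec_trans ac2 c2w.
move=> /(Sconf s t sS tS)[w [uw tw sw ntw]]; exists w; split=> //.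
exact: descendant_trans (xv _ v2x) (descendant_trans v2u uw).
Qed.

Variable h : nat.
Hypothesis branching : forall y, depth y < h -> 3 <= #|children r y|.

(** Each new conflicting vertex costs two levels, since a [crown] is built below a grandchild of
    [x]. *)
Lemma exists_conflicting n x : depth x + n.*2 <= h ->
  exists S : {set T},
    [/\ #|S| = n.+1, {in S, forall s, descendant x s} & conflicting S x].
Proof.
elim: n x => [|n IHn] x le_h.
  exists [set x]; split; first by rewrite cards1.
    by move=> s /set1P->; apply: descendant_refl.
  by move=> s t /set1P-> /set1P->; rewrite prec_irr.
have has_crown v : v \in children r x -> exists c, crown n v c.
  rewrite inE => /andP[_ /eqP dv].
  have /branching : depth v < h by lia.
  move=> /ltnW/ltnW; rewrite card_gt0 => /set0Pn[u]; rewrite !inE => uv.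
  have du : depth u = (depth x).+2 by case/andP: uv => _ /eqP->; rewrite dv.
  have [|S [cardS Su Sconf]] := IHn u; first by lia.
  have /set0Pn[s sS] : S != set0 by rewrite -card_gt0 cardS.
  have [c cS c_max] := prec_max sS; exists c, S, u; split=> //; split=> //.
  have : u \in children r v by rewrite inE.
  by rewrite mem_children => /andP[_ /eqP].
have /branching/card_gt2P : depth x < h by lia.
case=> v1 [v2 [v3 [[v1x v2x v3x] [neq12 neq23 neq31]]]].
have [c1 cr1] := has_crown v1 v1x; have [c2 cr2] := has_crown v2 v2x.
have [c3 cr3] := has_crown v3 v3x.
have ordered v w c d : v \in children r x -> w \in children r x -> v != w ->
    crown n v c -> crown n w d -> prec c d \/ prec d c.
  move=> vx wx neq_vw /crown_descendant vc /crown_descendant wd.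
  apply/orP/prec_total; apply: contraNneq neq_vw => eq_cd; rewrite eq_cd in vc.
  apply/eqP/(descendant_depth_inj vc wd).
  by move: vx wx; rewrite !inE => /andP[_ /eqP->] /andP[_ /eqP->].
have neq21 : v2 != v1 by rewrite eq_sym.
have neq32 : v3 != v2 by rewrite eq_sym.
have neq13 : v1 != v3 by rewrite eq_sym.
(* Each of the eight patterns, the two cyclic ones included, contains a chain of two comparisons;
   its middle vertex becomes the [v2] of [conflicting_extend]. *)
have [lt12 | lt21] := ordered _ _ _ _ v1x v2x neq12 cr1 cr2;
have [lt23 | lt32] := ordered _ _ _ _ v2x v3x neq23 cr2 cr3;
have [lt31 | lt13] := ordered _ _ _ _ v3x v1x neq31 cr3 cr1.
- exact: (conflicting_extend v1x v2x v3x _ _ cr1 cr2 cr3).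
- exact: (conflicting_extend v1x v2x v3x _ _ cr1 cr2 cr3).
- exact: (conflicting_extend v3x v1x v2x _ _ cr3 cr1 cr2).
- exact: (conflicting_extend v1x v3x v2x _ _ cr1 cr3 cr2).
- exact: (conflicting_extend v2x v3x v1x _ _ cr2 cr3 cr1).
- exact: (conflicting_extend v2x v1x v3x _ _ cr2 cr1 cr3).
- exact: (conflicting_extend v3x v2x v1x _ _ cr3 cr2 cr1).
- exact: (conflicting_extend v3x v2x v1x _ _ cr3 cr2 cr1).
Qed.

(** [h./2] is the largest [n] available at the root, and [pblock] is injective on a conflicting
    set. *)
Lemma consistent_card P :
  partition P [set: T] -> consistent prec P -> h./2 < #|P|.
Proof.
move=> partP consP.
have [|S [cardS _ Sconf]] := @exists_conflicting h./2 r.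
  by rewrite depth_root; lia.
rewrite -cardS -(@card_in_imset _ _ (pblock P) S) => [|u v uS vS eq_uv].
  apply/subset_leq_card/subsetP => B /imsetP[u _ ->].
  by apply: pblock_mem; rewrite (cover_partition partP) inE.
have noconf s t : s \in S -> t \in S -> pblock P s = pblock P t -> ~ prec s t.
  move=> sS tS eq_st lt_st; have [w [_ tw sw /negP[]]] := Sconf s t sS tS lt_st.
  exact: consP lt_st tw eq_st sw.
have [//|/prec_total/orP[]] := eqVneq u v; first by move/noconf; case.
by move/noconf; case.
Qed.

End LowerBound.

(** * Upper bound: a lexicographic order on root paths *)

Section UpperBound.
Variable h : nat.
Hypothesis depth_le : forall x, depth x <= h.

(** Lexicographic order on these sequences is a preorder traversal, with siblings ordered by
    [enum_rank]. *)
Definition code x : seq nat :=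
  [seq (enum_rank y : nat) | y <- rev (traject parent x (depth x).+1)].

(* [#|T|] exceeds every rank, so a vertex at odd height comes after its proper
   descendants, and a vertex at even height before them. *)
Definition key x : seqlexi nat := code x ++ nseq (odd (h - depth x)) #|T|.

Lemma size_code x : size (code x) = (depth x).+1.
Proof. by rewrite size_map size_rev size_traject. Qed.

Lemma code_child x : x != r ->
  code x = rcons (code (parent x)) (enum_rank x).
Proof.
by move=> /parentP[_ dx]; rewrite /code dx trajectS rev_cons map_rcons.
Qed.

Lemma prefix_code_key x y : prefix (code x) (key y) -> descendant x y.
Proof.
case/prefixP=> s key_y.
(* The default equals the entry that [key] may append and exceeds every rank, so reading past
   [code y] cannot give the rank of [x]. *)
have : nth #|T| (key y) (depth x) = enum_rank x.
  rewrite key_y nth_cat size_code ltnSn (nth_map x) ?size_rev ?size_traject //.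
  by rewrite nth_rev ?size_traject // subnn.
rewrite nth_cat size_code; case: ltnP => [le_xy|_]; last first.
  rewrite nth_nseq if_same => xE.
  by have := ltn_ord (enum_rank x); rewrite -xE ltnn.
rewrite (nth_map y) ?size_rev ?size_traject // nth_rev ?size_traject //.
rewrite nth_traject; last by rewrite ltnS subSS leq_subr.
by move=> /val_inj/enum_rank_inj<-; apply: fconnect_iter.
Qed.

Lemma key_inj : injective key.
Proof.
move=> x y eq_xy.
have xy : descendant x y by apply: prefix_code_key; rewrite -eq_xy prefix_prefix.
have yx : descendant y x by apply: prefix_code_key; rewrite eq_xy prefix_prefix.
apply: (descendant_depth_inj xy (descendant_refl y)).
by apply/eqP; rewrite eqn_leq !depth_descendant.
Qed.

(** This puts a vertex ordered between a parent and its child into the subtree of the parent, whose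
    [code] is a prefix of both keys. *)
Lemma prefix_between (p s1 s2 t : seq nat) :
  (p ++ s1 < t :> seqlexi nat)%O -> (t < p ++ s2 :> seqlexi nat)%O -> prefix p t.
Proof.
elim: p t => [|n p IHp] [|k t] //=; rewrite ?ltxis0 // !ltxi_cons !leEnat.
case/andP=> le_nk + /andP[le_kn]; rewrite le_nk le_kn /= => lt1 lt2.
by rewrite IHp // andbT eqn_leq le_nk.
Qed.

Let height_class x := (h - depth x)./2.

(** By [prefix_between], [v] descends from the upper end of the edge. If that end is [w], its height
    is odd and its class also holds the level of its children. If it is [u], its height is even and
    its class holds no deeper level. *)
Lemma key_consistent u v w :
  (key u < key v)%O -> (key v < key w)%O ->
  height_class u = height_class v -> adj u w -> adj v w.
Proof.
move=> uv vw; rewrite /height_class => eq_uv uw.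
have neq_uv : u != v by apply: contraTneq uv => ->; rewrite ltxx.
have neq_vw : v != w by apply: contraTneq vw => ->; rewrite ltxx.
have le_u := depth_le u; have le_v := depth_le v; have le_w := depth_le w.
have lt_uw := lt_trans uv vw.
case: (adj_parent uw) => -[xr px]; have [_ dx] := parentP xr; rewrite px in dx.
  have keyu := code_child xr; rewrite px in keyu.
  have wv : descendant w v.
    apply: prefix_code_key; apply: prefix_between vw.
    by move: uv; rewrite {1}/key keyu cat_rcons; apply.
  have odd_w : odd (h - depth w).
    apply: contraTT lt_uw => /negbTE even_w.
    rewrite /key even_w cats0 keyu cat_rcons.
    rewrite -leNgt; elim: (code w) => [|n s IHs] /=; first exact: lexi0s.
    by rewrite eqhead_lexiE.
  have neq_d : depth v != depth w.
    apply: contraNneq neq_vw => eq_d.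
    by apply/eqP/esym/(descendant_depth_inj wv (descendant_refl v)).
  (* [u] and [v] share a class, whose two levels are that of [w] and that of its children. *)
  have le_d := depth_descendant wv; have dv : depth v = (depth w).+1 by lia.
  have vr : v != r by rewrite -depth_eq0 dv.
  have [vp dpv] := parentP vr.
  suff -> : w = parent v by [].
  apply: (descendant_depth_inj wv); first exact: fconnect1.
  by apply/eqP; rewrite -eqSS -dpv dv.
have keyw := code_child xr; rewrite px in keyw.
have even_u : ~~ odd (h - depth u).
  apply: contraTN lt_uw => odd_u; rewrite /key odd_u keyw cat_rcons -leNgt.
  elim: (code u) => [|n s IHs] /=; last by rewrite eqhead_lexiE.
  by rewrite lexi_cons !leEnat ltnW //= leqNgt ltn_ord.
have uv_desc : descendant u v.
  apply: prefix_code_key; apply: (prefix_between uv).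
  by move: vw; rewrite {2}/key keyw cat_rcons; apply.
have le_d := depth_descendant uv_desc.
have eq_d : depth u = depth v by lia.
by rewrite (descendant_depth_inj uv_desc (descendant_refl v) eq_d) eqxx in neq_uv.
Qed.

Lemma thin_le : thin T <= uphalf h.+1.
Proof.
pose P := preim_partition height_class [set: T].
have partP : partition P [set: T] := preim_partitionP _ _.
have le_P : #|P| <= uphalf h.+1.
  pose fiber (i : 'I_(uphalf h.+1)) := [set x | height_class x == i].
  (* Some fibers may be empty, so inclusion is all that can be claimed. *)
  suff sub_P : P \subset [set fiber i | i : 'I_(uphalf h.+1)].
    apply: leq_trans (subset_leq_card sub_P) (leq_trans (leq_imset_card _ _) _).
    by rewrite card_ord.
  apply/subsetP => B /imsetP[x _ ->].
  have lt_x : height_class x < uphalf h.+1 by rewrite /height_class; lia.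
  apply/imsetP; exists (Ordinal lt_x) => //.
  by apply/setP => y; rewrite !inE eq_sym.
apply: leq_trans le_P; rewrite /thin; case: ex_minnP => k _; apply.
apply/asboolP; exists (fun u v => (key u < key v)%O), P; split=> //.
- split=> [u | v u w | u v neq_uv]; [exact: ltxx | exact: lt_trans |].
  by rewrite -neq_lt (inj_eq key_inj).
move=> u v w uv vw eq_uv; apply: (key_consistent uv vw).
have : v \in pblock P u by rewrite eq_uv mem_pblock (cover_partition partP) inE.
have eqR : {in [set: T] & &,
    equivalence_rel [rel x y | height_class x == height_class y]}.
  by move=> x y z _ _ _ /=; split=> // /eqP->.
by rewrite (pblock_equivalence_partition eqR) ?inE // => /eqP.
Qed.

End UpperBound.

End Tree.

(* uphalf n is the ceiling of n / 2 *)
Theorem theorem19 (m h : nat) (T : sgraph) (r : T) :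
  3 <= m ->
  complete_mary_tree r m ->
  height r = h ->
  thin T = uphalf h.+1.
Proof.
move=> m_ge3 [[treeT branching] leaf_depth] heightE.
(* A deepest vertex is a leaf, and all leaves share its depth; this identifies [h] with the largest
   depth. *)
have [z _ z_max] := arg_maxnP (dist r) (isT : xpredT r).
have leafz : leaf r z.
  apply/negPn/negP => /set0Pn[y]; rewrite inE => /andP[_ /eqP dy].
  by have /= := z_max y isT; rewrite dy ltnn.
have simple_size q : path adj r q -> uniq (r :: q) -> dist r (last r q) = size q.
  move=> q_path q_uniq; rewrite depth_simple_path // ?depth_root // => y ry.
  rewrite leqn0 depth_eq0 // => /eqP yr.
  by rewrite yr adj_irr in ry.
have dist_z : dist r z = h.
  apply/eqP; rewrite eqn_leq -heightE; apply/andP; split.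
    have /connectP[p /shortenP[q q_path q_uniq _] zE] := depth_connected r treeT z.
    have lt_q := uniq_size_lt_card q_uniq.
    rewrite zE simple_size //.
    rewrite /height; apply: (bigop.bigmax_sup (Ordinal lt_q)) => //.
    by apply/existsP; exists (in_tuple q); rewrite q_path q_uniq -zE.
  apply/bigmax_leqP => n /existsP[q /and3P[q_path q_uniq q_leaf]].
  by rewrite (leaf_depth z _ leafz q_leaf) simple_size // size_tuple.
have dist_le x : dist r x <= h by rewrite -dist_z; apply: z_max.
apply/eqP; rewrite eqn_leq (thin_le treeT dist_le) /=.
rewrite /thin; case: ex_minnP => k /asboolP[prec [P [order_prec partP <- consP]]] _.
apply: (@consistent_card _ r treeT _ order_prec h _ _ partP consP) => y lt_y.
(* All leaves have depth [h], so a vertex of smaller depth has [m] children. *)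
rewrite branching //; apply: contraTN lt_y => /leaf_depth/(_ leafz).
by rewrite dist_z => ->; rewrite ltnn.
Qed.
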